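(* Let $(V,\Sigma,\nu)$ be an infinite measure space of voters with $\nu$ atomless and $\nu(V)=1$, and let $C=\{c_1,c_2,c_3\}$. Then every measurable social welfare function on $V$ and $C$ satisfying CC (Condorcet cycle domain), MIIA, A (anonymity) and N (neutrality) is an unweighted Borda rule.
   Context: Setting. $\mathfrak{R}$ is the set of bijections $r:C\to\{0,1,2\}$ (rankings; a larger value means ranked higher), with the discrete $\sigma$-algebra; a ranking is also written as a list from best to worst, so $c_1c_2c_3$ is $c_i\mapsto 3-i$. $\mathfrak{R}_=$ is the set of weak orderings $\succ$ of $C$ (an equivalence relation of tying together with a total order of winning on the classes; $c_i\succ c_j$ means $c_i$ strictly beats $c_j$). A social welfare function (SWF) is a function $F:E\to\mathfrak{R}_=$ where $E$ is a set of measurable functions $V\to\mathfrak{R}$ (elections). For $i\neq j$: $\pi_{i,j}(r)=r(c_i)-r(c_j)\in D_3=\{-2,-1,1,2\}$; for $e\in E$, $\pi_{i,j}(e):V\to D_3$ is $v\mapsto\pi_{i,j}(e(v))$; $A_{i,j}=\pi_{i,j}(E)$; for $\succ\in\mathfrak{R}_=$, $\pi_{i,j}(\succ)=W$ if $c_i\succ c_j$, $L$ if $c_j\succ c_i$, $T$ otherwise. Conditions on $F$: - CC: $E$ is the set of all measurable functions $V\to\mathfrak{C}$ where $\mathfrak{C}=\{c_1c_2c_3,\ c_2c_3c_1,\ c_3c_1c_2\}$. - MIIA: for all $i\ne j$ there is $f_{i,j}:A_{i,j}\to\{W,T,L\}$ with $f_{i,j}(\pi_{i,j}(e))=\pi_{i,j}(F(e))$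 for all $e\in E$. - A: $F=F'\circ\tau$ for some function $F':\tau(E)\to\mathfrak{R}_=$, where $\tau(e)(r)=\nu(e^{-1}(r))$. - N: for every permutation $\rho$ of $C$ and all $e\in E$ with $\rho\circ e\in E$, $F(\rho\circ e)=\rho(F(e))$. Here $(\rho\circ e)(v)=\rho(e(v))$ with $\rho(r)=r\circ\rho^{-1}$, and $\rho(\succ)$ is the weak ordering in which $\rho(c_i)$ beats $\rho(c_j)$ iff $c_i\succ c_j$. Measurability: under CC, $\tau(E)$ is the two-dimensional simplex $\{\vec\varepsilon\in\mathbb{R}_{\ge0}^{\mathfrak{C}}:\sum_{r}\varepsilon_r=1\}$. An anonymous SWF $F=F'\circ\tau$ is measurable if $F'$ is a measurable function from this simplex, with (two-dimensional) Lebesgue measure, to $\mathfrak{R}_=$ with the discrete $\sigma$-algebra. Unweighted Borda rules: for a constant $w\in\mathbb{R}$, the SWF ranking candidates by the score $b_w(c,e)=w\int_V e(v)(c)\,d\nu(v)$ ($c_i$ beats $c_j$ iff $b_w(c_i,e)>b_w(c_j,e)$). There are three: positive ($w=1$), negative ($w=-1$), and the tie rule ($w=0$), under which all candidates are always tied. *)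

(* Defs.v *)
From HB Require Import structures.
From mathcomp Require Import all_boot all_order all_algebra all_fingroup.
From mathcomp Require Import all_classical all_reals all_analysis.
From mathcomp Require Import measurable_realfun.
Set Implicit Arguments.
Unset Strict Implicit.
Unset Printing Implicit Defensive.
Import Order.TTheory GRing.Theory Num.Theory.
Import numFieldNormedType.Exports.
Local Open Scope classical_set_scope.
Local Open Scope ring_scope.

Notation cand := 'I_3.
Definition c1 : cand := @Ordinal 3 0 isT.
Definition c2 : cand := @Ordinal 3 1 isT.
Definition c3 : cand := @Ordinal 3 2 isT.

(* A bijection from the candidates to {0,1,2}; both sides are 'I_3. *)
Definition ranking := {perm 'I_3}.

HB.instance Definition _ := Choice.on ranking.
HB.instance Definition _ := isPointed.Build ranking (1%g : {perm 'I_3}).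
HB.instance Definition _ := @isMeasurable.Build default_measure_display
  ranking discrete_measurable discrete_measurable0
  discrete_measurableC discrete_measurableU.

Definition rank_value (r : ranking) (c : cand) : nat := (r : {perm 'I_3}) c.

(* [r] is the ranking written a b c from best to worst. *)
Definition listed (r : ranking) (a b c : cand) : bool :=
  [&& rank_value r a == 2, rank_value r b == 1 & rank_value r c == 0]%N.

(* The product of permutations applies the left factor first, so this is
   c |-> r (rho^-1 c). *)
Definition rank_act (rho : {perm cand}) (r : ranking) : ranking :=
  (rho^-1 * (r : {perm 'I_3}))%g.

Definition tied (b : rel cand) : rel cand :=
  fun i j => ~~ b i j && ~~ b j i.

(* Ties form an equivalence relation, and winning is well defined on its
   classes and orders them strictly; totality holds by definition of [tied]. *)
Record weak_order := WeakOrder {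
  beats :> rel cand;
  beats_irr : irreflexive beats;
  beats_trans : transitive beats;
  tied_equiv : equivalence_rel (tied beats);
  beats_tied : forall i i' j j',
    tied beats i i' -> tied beats j j' -> beats i j = beats i' j'
}.

Section WeakOrderAction.
Variables (rho : {perm cand}) (w : weak_order).

Definition act_beats : rel cand :=
  fun i j => beats w ((rho^-1)%g i) ((rho^-1)%g j).

Lemma act_beats_irr : irreflexive act_beats.
Proof. by move=> i; exact: beats_irr. Qed.

Lemma act_beats_trans : transitive act_beats.
Proof. by move=> j i k; exact: beats_trans. Qed.

Lemma act_tied_equiv : equivalence_rel (tied act_beats).
Proof. by move=> i j k; exact: (tied_equiv w). Qed.

Lemma act_beats_tied i i' j j' :
  tied act_beats i i' -> tied act_beats j j' -> act_beats i j = act_beats i' j'.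
Proof. exact: beats_tied. Qed.

Definition weak_act : weak_order :=
  WeakOrder act_beats_irr act_beats_trans act_tied_equiv act_beats_tied.

End WeakOrderAction.

Inductive outcome := Win | Tie | Loss.

Definition order_outcome (i j : cand) (w : weak_order) : outcome :=
  if beats w i j then Win else if beats w j i then Loss else Tie.

Definition rank_diff (i j : cand) (r : ranking) : int :=
  (rank_value r i)%:Z - (rank_value r j)%:Z.

Definition to_image (T U : Type) (E : set T) (g : T -> U) (x : set_type E) :
    set_type (g @` E) :=
  SigSub (mem_set (imageP g (set_valP x))).

Record swf d (V : measurableType d) := SWF {
  dom : set (V -> ranking);
  dom_measurable : forall e, dom e -> measurable_fun [set: V] e;
  swf_fun :> set_type dom -> weak_order
}.

Section Conditions.
Context d (V : measurableType d) (R : realType).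
Variables (nu : probability V R) (F : swf V).

Definition atomless : Prop :=
  forall A : set V, measurable A -> (0 < nu A)%E ->
    exists B : set V, [/\ measurable B, B `<=` A, (0 < nu B)%E & (nu B < nu A)%E].

Definition condorcet_cycle (r : ranking) : bool :=
  [|| listed r c1 c2 c3, listed r c2 c3 c1 | listed r c3 c1 c2].

Definition CC : Prop :=
  dom F = [set e | measurable_fun [set: V] e /\ forall v, condorcet_cycle (e v)].

Definition diff_profile (i j : cand) (e : V -> ranking) : V -> int :=
  fun v => rank_diff i j (e v).

Definition MIIA : Prop :=
  forall i j : cand, i != j ->
    exists f : set_type (diff_profile i j @` dom F) -> outcome,
      forall e : set_type (dom F),
        f (to_image (diff_profile i j) e) = order_outcome i j (F e).

Definition tau (e : V -> ranking) : ranking -> R :=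
  fun r => fine (nu (e @^-1` [set r])).

Definition factors_through_tau
    (F' : set_type (tau @` dom F) -> weak_order) : Prop :=
  forall e : set_type (dom F), F e = F' (to_image tau e).

Definition anonymous : Prop :=
  exists F' : set_type (tau @` dom F) -> weak_order, factors_through_tau F'.

Definition neutral : Prop :=
  forall (rho : {perm cand}) (e e' : set_type (dom F)),
    (forall v, val e' v = rank_act rho (val e v)) ->
    F e' = weak_act rho (F e).

(* Affine chart of the plane spanned by the simplex on the three Condorcet
   cycle rankings: two of the weights are the coordinates. Another choice of
   two weights changes the chart by an affine automorphism of the plane, which
   preserves Lebesgue measurability. *)
Definition simplex_chart (z : R * R) : ranking -> R :=
  fun r => if listed r c1 c2 c3 then z.1
           else if listed r c2 c3 c1 then z.2
           else if listed r c3 c1 c2 then 1 - z.1 - z.2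
           else 0.

(* Lebesgue measurable subsets of the plane: the completion of the Borel
   sigma-algebra for two-dimensional Lebesgue measure. *)
Definition lebesgue_measurable2 : set (set (R * R)) :=
  completed_algebra_gen
    ((@lebesgue_measure R) \x (@lebesgue_measure R))%E.

(* The domain of F' is the whole simplex when [CC] holds and [nu] is atomless.
   All sets of weak orders are measurable. *)
Definition measurable_swf : Prop :=
  exists2 F' : set_type (tau @` dom F) -> weak_order,
    factors_through_tau F' &
    forall B : set weak_order, lebesgue_measurable2
      [set z | exists2 p, val p = simplex_chart z & B (F' p)].

Definition borda_score (w : R) (c : cand) (e : V -> ranking) : R :=
  w * \int[nu]_(v in [set: V]) (rank_value (e v) c)%:R.

Definition unweighted_borda_rule : Prop :=
  exists w : R, forall (e : set_type (dom F)) (i j : cand),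
    beats (F e) i j = (borda_score w j (val e) < borda_score w i (val e)).

End Conditions.

(* Main.v *)
From mathcomp Require Import all_boot all_order all_algebra all_fingroup.
From mathcomp Require Import all_classical all_reals all_analysis.
From mathcomp Require Import measurable_realfun lra.
Require Import Defs.
Set Implicit Arguments.
Unset Strict Implicit.
Unset Printing Implicit Defensive.
Import Order.TTheory GRing.Theory Num.Theory.
Import numFieldNormedType.Exports.
Local Open Scope classical_set_scope.
Local Open Scope ring_scope.

(** By MIIA, anonymity and the existence of events of every probability
    (atomlessness), the outcome of [c1] against [c2] depends only on the weight
    of [c2 c3 c1], the one cyclic ranking that puts [c1] below [c2]; by
    neutrality under rotation the same rule [h] decides [c2] against [c3] and
    [c3] against [c1] from the weights of the two other rankings. Centre it as
    [k a = h (1/3 + a)]. Consistency of weak orders says that whenever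
    [a + b + c = 0], the values of [k] at [a], [b], [c] are all ties or contain
    both a win and a loss. Hence [k 0] is a tie, [k] is odd near [0], and each
    level set of [k] is closed under sums of nonnegative elements. Some level
    set has positive measure, so by Steinhaus' theorem [k] is constant on an
    interval around some [q > 0]; every small [t > 0] has a multiple in that
    interval, so [k t] takes the same value, and additivity spreads it to all
    positive arguments. The three possible values are the three unweighted
    Borda rules. *)

(** * Steinhaus' theorem for sums *)

(** Uniqueness of Lebesgue measure: the pushforward under the reflection gives half-open intervals
    their length, the swap of the closed end being harmless. *)
Lemma lebesgue_measure_reflect (R : realType) (c : R) (A : set R) :
  measurable A ->
  lebesgue_measure ((fun x => c - x) @^-1` A) = lebesgue_measure A.
Proof.
move=> mA.
have mf : measurable_fun [set: measurableTypeR R]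
    ((fun x => c - x) : measurableTypeR R -> measurableTypeR R).
  by apply: measurable_funB => //; exact: measurable_id.
pose nu : {measure set (measurableTypeR R) -> \bar R} :=
  measure_function_pushforward__canonical__measure_function_Measure
    (@lebesgue_measure R) mf.
symmetry; apply: (@lebesgue_measure_unique R nu) => // _ [[a b] _ <-].
rewrite /nu /= /pushforward.
have -> : (fun x => c - x) @^-1` `]a, b] = `[c - b, c - a[%classic.
  apply/seteqP; split=> x /=;
    rewrite !in_itv /= => /andP[? ?]; apply/andP; split; lra.
rewrite !lebesgue_measure_itv /= !lte_fin ltrD2l ltrN2.
by case: ifPn => // _; rewrite -!EFinB; congr EFin; lra.
Qed.

(** If no point of [A] had density one, the density theorem would put [A] in a null set. Near a
    density point, [A] fills more than 3/4 of a ball of length [2 * r]; hence the factor 3/2. *)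
Lemma lebesgue_density_point (R : realType) (A : set R) :
  measurable A -> (0 < lebesgue_measure A)%E ->
  exists m r, [/\ 0 < r & ((r * (3 / 2))%:E < lebesgue_measure (A `&` ball m r))%E].
Proof.
move=> mA A0.
have [m Am dm] : exists2 m, A m &
    (lebesgue_measure (A `&` ball m r) * (lebesgue_measure (ball m r))^-1)%E
      @[r --> 0^'+] --> (1 : \bar R)%E.
  apply: contrapT => H.
  have [N [mN N0 sub]] := lebesgue_density mA.
  suff : (lebesgue_measure A <= lebesgue_measure N)%E by rewrite N0 leNgt A0.
  apply: le_measure; rewrite ?inE // => x Ax; apply: sub => /= Hx.
  by apply: H; exists x => //; move: Hx; rewrite indicE mem_set.
have : \forall r \near 0^'+, ((3 / 4)%:E <
    lebesgue_measure (A `&` ball m r) * (lebesgue_measure (ball m r))^-1)%E.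
  move/(_ [set y | ((3 / 4)%:E < y)%E]) : dm; apply.
  by apply: open_ereal_gt'; rewrite lte_fin; lra.
have r0 : \forall r \near (0:R)^'+, 0 < r by exact: nbhs_right_gt.
move=> H; near (0:R)^'+ => r.
have rgt0 : 0 < r by near: r.
exists m, r; split => //.
have : ((3 / 4)%:E <
    lebesgue_measure (A `&` ball m r) * (lebesgue_measure (ball m r))^-1)%E by near: r.
rewrite lebesgue_measure_ball ?ltW // inver mulrn_eq0/= gt_eqF//.
have : lebesgue_measure (A `&` ball m r) \is a fin_num.
  rewrite ge0_fin_numE//; apply: (@le_lt_trans _ _ (lebesgue_measure (ball m r))).
    apply: le_measure; rewrite ?inE //; last exact: measurable_ball.
    by apply: measurableI => //; exact: measurable_ball.
  by rewrite lebesgue_measure_ball ?ltW // ltry.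
case: (lebesgue_measure _) => //= u _; rewrite -EFinM !lte_fin ltr_pdivlMr ?mulrn_wgt0 //.
by rewrite -mulr_natr; lra.
Unshelve. all: by end_near. Qed.

(** Let [B] be the part of [A] in the ball of [lebesgue_density_point]. If [z] near [m + m] were not
    a sum, [B] and its reflection [z - B] would be disjoint sets of measure above [3r/2] inside a
    ball of length [3r]. *)
Lemma steinhaus_add (R : realType) (A : set R) :
  measurable A -> (0 < lebesgue_measure A)%E ->
  exists p e, 0 < e /\ forall z, `|z - p| < e ->
    exists x y, [/\ A x, A y & z = x + y].
Proof.
move=> mA A0; have [m [r [r0 Hr]]] := lebesgue_density_point mA A0.
exists (m + m), (r / 2); split; first by lra.
move=> z; rewrite ltr_norml => /andP[z1 z2].
set B := A `&` ball m r in Hr.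
have mB : measurable B by apply: measurableI => //; exact: measurable_ball.
set B' := (fun x => z - x) @^-1` B.
have mB' : measurable B'.
  have mf : measurable_fun [set: R] (fun x => z - x).
    by apply: measurable_funB => //; exact: measurable_id.
  by rewrite -[B']setTI; exact: mf.
have muB' : lebesgue_measure B' = lebesgue_measure B by exact: lebesgue_measure_reflect.
apply: contrapT => H.
have dis : B `&` B' = set0.
  apply/seteqP; split=> // x /= [[Ax _] [Azx _]]; apply: H.
  by exists x, (z - x); split => //; lra.
have sub : B `|` B' `<=` ball m (r * (3 / 2)).
  move=> x [[_]|[_]]; rewrite /ball /= !ltr_norml => /andP[? ?]; apply/andP; split; lra.
have : (lebesgue_measure (B `|` B') <= (r * (3 / 2) *+ 2)%:E)%E.
  rewrite -(lebesgue_measure_ball m); last lra.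
  apply: le_measure; rewrite ?inE //; first exact: measurableU.
  exact: measurable_ball.
have -> : lebesgue_measure (B `|` B') =
    (lebesgue_measure B + lebesgue_measure B)%E.
  by rewrite -{2}muB'; exact: measureU.
rewrite leNgt => /negP; apply.
by rewrite mulr2n EFinD; exact: lteD.
Qed.

(** * Rules consistent along a cycle *)

(* The outcomes of [c1] against [c2], [c2] against [c3] and [c3] against [c1]
   that can come from a common weak order. *)
Definition cyclic_consistent (a b c : outcome) : bool :=
  match a, b, c with
  | Tie, Tie, Tie => true
  | Win, Loss, _ | Loss, Win, _ | Win, _, Loss
  | Loss, _, Win | _, Win, Loss | _, Loss, Win => true
  | _, _, _ => false
  end.

Definition flip (o : outcome) : outcome :=
  match o with Win => Loss | Tie => Tie | Loss => Win end.

(** The arguments stand for the deviations from 1/3 of three nonnegative weights of sum 1. *)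
Definition cyclic_rule (R : realType) (k : R -> outcome) : Prop :=
  forall a b c, - (1/3) <= a -> - (1/3) <= b -> - (1/3) <= c ->
    a + b + c = 0 -> cyclic_consistent (k a) (k b) (k c).

Lemma cyclic_rule0 (R : realType) (k : R -> outcome) :
  cyclic_rule k -> k 0 = Tie.
Proof.
move=> H; have : cyclic_consistent (k 0) (k 0) (k 0) by apply: H; lra.
by case: (k 0).
Qed.

Lemma cyclic_ruleN (R : realType) (k : R -> outcome) (a : R) :
  cyclic_rule k -> - (1/3) <= a <= 1/3 -> k (- a) = flip (k a).
Proof.
move=> H /andP[a1 a2].
have : cyclic_consistent (k a) (k (- a)) (k 0) by apply: H; lra.
by rewrite (cyclic_rule0 H); case: (k a); case: (k (- a)).
Qed.

(** Consistency at [- a], [- b], [a + b]: oddness makes the first two values [flip s], which forces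
    the third to be [s]. *)
Lemma cyclic_ruleD (R : realType) (k : R -> outcome) (a b : R) (s : outcome) :
  cyclic_rule k -> 0 <= a <= 1/3 -> 0 <= b <= 1/3 ->
  k a = s -> k b = s -> k (a + b) = s.
Proof.
move=> H /andP[a1 a2] /andP[b1 b2] ka kb.
have : cyclic_consistent (k (- a)) (k (- b)) (k (a + b)) by apply: H; lra.
rewrite !(cyclic_ruleN H) ?ka ?kb; try (by apply/andP; split; lra).
by case: s {ka kb}; case: (k (a + b)).
Qed.

Lemma cyclic_ruleMn (R : realType) (k : R -> outcome) (n : nat) (a : R) :
  cyclic_rule k -> 0 <= a -> n.+1%:R * a <= 1/3 -> k (n.+1%:R * a) = k a.
Proof.
move=> H a0; elim: n => [|n IH]; first by rewrite (mul1r a).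
rewrite -natr1 mulrDl (mul1r a) => le13.
have na0 : 0 <= n.+1%:R * a by rewrite mulr_ge0.
have a3 : n.+1%:R * a <= 1 / 3 by lra.
apply: (cyclic_ruleD H) => //; first by apply/andP.
  by apply/andP; split; lra.
exact: IH.
Qed.

(** The value spreads from the interval to small [t] by taking multiples, then to [t <= 1/3] by
    division into small parts, then to [t <= 2/3] by doubling. *)
Lemma cyclic_rule_interval (R : realType) (k : R -> outcome) (q e : R) s :
  cyclic_rule k -> 0 < e -> (forall z, `|z - q| < e -> 0 <= z <= 1/3) ->
  (forall z, `|z - q| < e -> k z = s) ->
  forall t, 0 < t <= 2/3 -> k t = s.
Proof.
move=> H e0 I01 Is.
have q0 : 0 < q.
  have : `|q - e / 2 - q| < e by rewrite ltr_norml; apply/andP; split; lra.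
  by move/I01 => /andP[]; lra.
have q1 : q <= 1/3.
  by have /I01 /andP[] : `|q - q| < e by rewrite subrr normr0.
have small t : 0 < t -> t < e -> t < q -> k t = s.
  move=> t0 te tq.
  have qt0 : 0 <= q / t by rewrite divr_ge0 ?ltW.
  have /andP[] := truncn_itv qt0.
  (* [n.+1 * t] is the largest multiple of [t] not above [q]; as [t < e], it lies within [e] of [q].
     A zero quotient would mean [q < t]. *)
  case E : (Num.trunc _) => [|n].
    by rewrite ltr_pdivrMr // (mul1r t) => _ ?; exfalso; lra.
  rewrite ler_pdivlMr // ltr_pdivrMr // => n1 n2.
  have <- : k (n.+1%:R * t) = k t.
    by apply: cyclic_ruleMn => //; [exact: ltW | exact: le_trans n1 q1].
  apply: Is; rewrite ltr_norml; move: n2; rewrite -natr1 mulrDl (mul1r t) => n2.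
  by apply/andP; split; lra.
have med t : 0 < t <= 1/3 -> k t = s.
  move=> /andP[t0 t1].
  pose m := Num.min e q.
  have m0 : 0 < m by rewrite /m lt_min e0 q0.
  have tm0 : 0 <= t / m by rewrite divr_ge0 ?ltW.
  have /andP[_] := truncn_itv tm0.
  set n := Num.trunc _; rewrite ltr_pdivrMr // => n2.
  have n0 : (0 : R) < n.+1%:R by rewrite ltr0n.
  have nz : (n.+1%:R : R) != 0 by rewrite gt_eqF.
  have := @cyclic_ruleMn _ k n (t / n.+1%:R) H.
  rewrite mulrCA divff // (mulr1 t) => -> //; last by rewrite divr_ge0 // ltW.
  have : t / n.+1%:R < m by rewrite ltr_pdivrMr // mulrC.
  by rewrite lt_min => /andP[? ?]; apply: small => //; rewrite divr_gt0.
move=> t /andP[t0 t1]; have -> : t = t / 2 + t / 2 by lra.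
by apply: (cyclic_ruleD H); try (apply/andP; split; lra); apply: med; apply/andP; split; lra.
Qed.

(** The shift [u] turns weights into deviations. Steinhaus makes the sums of two elements of the
    shifted set fill an interval, where [cyclic_ruleD] gives the value [s]; the bound 1/6 keeps
    these sums below 1/3. *)
Lemma cyclic_rule_measurable (R : realType) (k : R -> outcome) (A : set R) u s :
  cyclic_rule k -> measurable A -> (0 < lebesgue_measure A)%E ->
  (forall a, A a -> 0 <= a - u <= 1/6 /\ k (a - u) = s) ->
  forall t, 0 < t <= 2/3 -> k t = s.
Proof.
move=> H mA A0 As; have [p [e [e0 St]]] := steinhaus_add mA A0.
have split z : `|z - (p - u - u)| < e -> exists a b,
    [/\ A a, A b & z = (a - u) + (b - u)].
  move=> ze; have [a [b [Aa Ab zab]]] : exists a b, [/\ A a, A b & z + u + u = a + b].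
    by apply: St; rewrite (_ : _ - p = z - (p - u - u)) //; lra.
  by exists a, b; split => //; lra.
apply: (@cyclic_rule_interval _ k (p - u - u) e) => // z /split
    [a [b [/As[/andP[? ?] ka] /As[/andP[? ?] kb] ->]]].
  by apply/andP; split; lra.
by apply: (cyclic_ruleD H) => //; apply/andP; split; lra.
Qed.

Definition compare_outcome (R : realType) (x y : R) : outcome :=
  if y < x then Win else if x < y then Loss else Tie.

Lemma compare_outcome_gt (R : realType) (x y : R) :
  y < x -> compare_outcome x y = Win.
Proof. by rewrite /compare_outcome => ->. Qed.

Lemma compare_outcome_lt (R : realType) (x y : R) :
  x < y -> compare_outcome x y = Loss.
Proof. by move=> xy; rewrite /compare_outcome xy ltNge ltW. Qed.

Lemma compare_outcome_eq (R : realType) (x y : R) :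
  x = y -> compare_outcome x y = Tie.
Proof. by move=> ->; rewrite /compare_outcome ltxx. Qed.

Lemma cyclic_rule_compare (R : realType) (k : R -> outcome) s :
  cyclic_rule k -> (forall t, 0 < t <= 2/3 -> k t = s) ->
  exists w : R, forall t a b, - (1/3) <= t <= 2/3 -> b - a = 3 * t ->
    k t = compare_outcome (w * a) (w * b).
Proof.
move=> H Hs.
(* [b - a] has the sign of [t], so a win at positive [t] favours the smaller score [a]: the weight
   is then negative. *)
pose w : R := match s with Win => -1 | Tie => 0 | Loss => 1 end.
exists w => t a b /andP[t1 t2] ab.
have [t0|t0|t0] := ltgtP t 0.
- have Es : k (- t) = s by apply: Hs; apply/andP; split; lra.
  have -> : k t = flip s.
    by rewrite -[t]opprK (cyclic_ruleN H) ?Es //; apply/andP; split; lra.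
  rewrite /w; case: (s) => /=.
  + by rewrite compare_outcome_lt //; lra.
  + by rewrite compare_outcome_eq //; lra.
  + by rewrite compare_outcome_gt //; lra.
- rewrite Hs ?t0 // /w; case: (s) => /=.
  + by rewrite compare_outcome_gt //; lra.
  + by rewrite compare_outcome_eq //; lra.
  + by rewrite compare_outcome_lt //; lra.
- by rewrite t0 (cyclic_rule0 H) compare_outcome_eq //; congr (_ * _); lra.
Qed.

(** * Sections of Lebesgue measurable sets of the plane *)

Section PlaneSections.
Context (R : realType).
Local Notation mu := (@lebesgue_measure R).

(** [S] is a measurable set together with a negligible one, so the measurable part has positive
    measure. That measure is the integral of the measures of the vertical sections, which cannot all
    vanish. *)
Lemma plane_positive_section (S : set (R * R)) :
  lebesgue_measurable2 S -> ~ (mu \x mu)%E.-negligible S ->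
  exists x (A : set R), [/\ measurable A, (0 < mu A)%E &
    forall y, A y -> S (x, y)].
Proof.
move=> [A mA [N negN ANS]] nonneg.
have A0 : ((mu \x mu) A != 0)%E.
  apply/eqP => A0; apply: nonneg; rewrite -ANS; apply: negligibleU => //.
  exact/negligibleP.
have [x Ax] : exists x, (mu (xsection A x) != 0)%E.
  apply: contrapT => H; case/eqP: A0; apply: integral0_eq => x _ /=.
  by apply/eqP/negPn/negP => ?; apply: H; exists x.
exists x, (xsection A x); split.
- exact: measurable_xsection.
- by rewrite lt0e Ax measure_ge0.
- by move=> y /xsectionP Axy; rewrite -ANS; left.
Qed.

Lemma lebesgue_measurable2_setI (S Q : set (R * R)) :
  lebesgue_measurable2 S -> measurable Q -> lebesgue_measurable2 (S `&` Q).
Proof.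
move=> [A mA [N negN <-]] mQ; exists (A `&` Q); first exact: measurableI.
exists (N `&` Q); last by rewrite setIUl.
by apply: negligibleS negN => z [].
Qed.

Lemma rectangle_not_negligible (a b c e : R) : a < b -> c < e ->
  ~ (mu \x mu)%E.-negligible (`[a, b] `*` `[c, e]).
Proof.
move=> ab ce /measure_negligible.
move=> /(_ (measurableX (measurable_itv _) (measurable_itv _))).
have := @product_measure1E _ _ _ _ R mu mu _ _
  (measurable_itv `[a, b]) (measurable_itv `[c, e]).
move=> /= -> /eqP.
rewrite !lebesgue_measure_itv /= !lte_fin ab ce -!EFinB -EFinM eqe mulf_eq0.
by rewrite !subr_eq0 !gt_eqF.
Qed.

End PlaneSections.

(** * Events of prescribed probability *)

Section AtomlessValues.
Context d (V : measurableType d) (R : realType) (nu : probability V R).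

Local Notation m A := (fine (nu A)).

Lemma probability_fineK (A : set V) : measurable A -> nu A = (m A)%:E.
Proof. by move=> mA; rewrite fineK // fin_num_measure. Qed.

Lemma le_fine_probability (A B : set V) :
  measurable A -> measurable B -> A `<=` B -> m A <= m B.
Proof.
move=> mA mB AB; rewrite -lee_fin -!probability_fineK //.
by apply: le_measure; rewrite ?inE.
Qed.

Lemma fine_probabilityU (A B : set V) : measurable A -> measurable B ->
  A `&` B = set0 -> m (A `|` B) = m A + m B.
Proof.
move=> mA mB AB; apply: EFin_inj; rewrite EFinD -!probability_fineK //.
  exact: measureU.
exact: measurableU.
Qed.

Lemma fine_probabilityD (A B : set V) : measurable A -> measurable B ->
  B `<=` A -> m (A `\` B) = m A - m B.
Proof.
move=> mA mB BA; have mD : measurable (A `\` B) by exact: measurableD.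
rewrite -{2}(setDUK BA) fine_probabilityU //; last by rewrite setDIK.
by rewrite addrAC subrr add0r.
Qed.

(** Atomlessness splits a set into two pieces of positive measure, and one of them has at most half
    of the measure. *)
Lemma atomless_halve (S : set V) (n : nat) : atomless nu ->
  measurable S -> 0 < m S ->
  exists B, [/\ measurable B, B `<=` S, 0 < m B & m B * 2 ^+ n <= m S].
Proof.
move=> al mS S0; elim: n => [|n [B [mB BS B0 Bn]]].
  by exists S; split; rewrite ?expr0 ?mulr1.
have : (0 < nu B)%E by rewrite probability_fineK.
move=> /(al _ mB)[C [mC CB]].
rewrite (probability_fineK mB) (probability_fineK mC) !lte_fin => C0 CltB.
have mD : measurable (B `\` C) by exact: measurableD.
have eD : m (B `\` C) = m B - m C by exact: fine_probabilityD.
have p0 : (0 : R) < 2 ^+ n by exact: exprn_gt0.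
have [le|gt] := leP (m C *+ 2) (m B).
  exists C; split => //; first exact: subset_trans BS.
  by apply: le_trans Bn; rewrite exprS mulrA ler_pM2r // mulr_natr.
exists (B `\` C); split => //.
- by apply: subset_trans BS => x [].
- by rewrite eD subr_gt0.
- apply: le_trans Bn; rewrite exprS mulrA ler_pM2r // eD.
  by move: gt; rewrite mulr2n; lra.
Qed.

(** More than [m S / e] halvings suffice, since [n < 2 ^ n]. *)
Lemma atomless_small (S : set V) (e : R) : atomless nu ->
  measurable S -> 0 < m S -> 0 < e ->
  exists B, [/\ measurable B, B `<=` S, 0 < m B & m B <= e].
Proof.
move=> al mS S0 e0.
have Se0 : 0 <= m S / e by rewrite divr_ge0 ?ltW.
have /andP[_] := truncn_itv Se0.
set n := Num.trunc _; rewrite ltr_pdivrMr // => n2.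
have [B [mB BS B0 Bn]] := atomless_halve n.+1 al mS S0.
exists B; split => //.
have p0 : (0 : R) < 2 ^+ n.+1 by exact: exprn_gt0.
rewrite -(ler_pM2r p0); apply: le_trans Bn _; apply: ltW.
apply: lt_le_trans n2 _; rewrite mulrC ler_pM2l // -natrX ler_nat.
exact/ltnW/ltn_expl.
Qed.

(* [A'] gains at least half of what any extension within the bound [t] gains. *)
Lemma greedy_step (S A : set V) (t : R) :
  measurable A -> A `<=` S -> m A <= t ->
  exists A', [/\ measurable A', A `<=` A', A' `<=` S, m A' <= t &
    forall C, measurable C -> A `<=` C -> C `<=` S -> m C <= t ->
      m C - m A <= 2 * (m A' - m A)].
Proof.
move=> mA AS At.
pose X := [set m C | C in
  [set C | [/\ measurable C, A `<=` C, C `<=` S & m C <= t]]].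
have XA : X (m A) by exists A => //; split.
have hX : has_sup X.
  by split; [exists (m A) | exists t => _ [C [_ _ _ ?] <-]].
have XleS C : X C -> C <= sup X by move=> XC; apply: sup_upper_bound.
have [le|gt] := leP (sup X) (m A).
  exists A; split => // C mC AC CS Ct; rewrite subrr mulr0 subr_le0.
  by apply: le_trans le; apply: XleS; exists C.
(* Coming within half of the largest conceivable gain secures at least half of any gain. *)
have e0 : 0 < (sup X - m A) / 2 by lra.
have [_ [C [mC AC CS Ct] <-] Cs] := sup_adherent e0 hX.
exists C; split => // D mD AD DS Dt.
have : m D <= sup X by apply: XleS; exists D.
by move: Cs; lra.
Qed.

(** Greedy exhaustion: [greedy_step] is iterated from the empty set, and the union of the resulting
    chain has measure exactly [t]. *)
Lemma atomless_intermediate (S : set V) (t : R) : atomless nu ->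
  measurable S -> 0 <= t <= m S ->
  exists A, [/\ measurable A, A `<=` S & m A = t].
Proof.
move=> al mS /andP[t0 tS].
pose ok A := [/\ measurable A, A `<=` S & m A <= t].
have /choice[nxt nxtP] : forall A : set V, exists A', ok A ->
    [/\ ok A', A `<=` A' & forall C, ok C -> A `<=` C ->
      m C - m A <= 2 * (m A' - m A)].
  move=> A; have [[mA AS At]|nok] := pselect (ok A); last by exists A.
  have [A' [mA' AA' A'S A't H]] := greedy_step mA AS At.
  by exists A' => _; split => // C [mC CS Ct] AC; exact: H.
pose U n := iter n nxt set0.
have okU n : ok (U n).
  elim: n => [|n IH]; last by have [] := nxtP _ IH.
  by split; [exact: measurable0 | exact: sub0set | rewrite measure0].
have mU n : measurable (U n) by have [] := okU n.
have UU n : U n `<=` U n.+1 by have [] := nxtP _ (okU n).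
have ndU : nondecreasing_seq U.
  by apply/nondecreasing_seqP => n; apply/subsetPset; exact: UU.
pose A := \bigcup_n U n.
have mA : measurable A by exact: bigcupT_measurable.
have AS : A `<=` S by move=> x [n _]; have [_ + _] := okU n; apply.
have At : m A <= t.
  rewrite -lee_fin -probability_fineK //.
  have cv := @nondecreasing_cvg_mu _ _ _ nu U mU mA ndU.
  rewrite -(cvg_lim _ cv) //; apply: lime_le.
    by apply/cvg_ex; eexists; exact: cv.
  apply: nearW => n /=; rewrite probability_fineK // lee_fin.
  by have [] := okU n.
(* Otherwise a set [B] of positive measure could be added at every step, so
   that each step gains at least half the measure of [B]. *)
exists A; split => //; apply/eqP; rewrite eq_le At /= leNgt; apply/negP => lt.
have mD : measurable (S `\` A) by exact: measurableD.
have eD : m (S `\` A) = m S - m A by exact: fine_probabilityD.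
have [B [mB BSA B0 Bt]] : exists B,
    [/\ measurable B, B `<=` S `\` A, 0 < m B & m B <= t - m A].
  by apply: atomless_small => //; rewrite ?eD; lra.
have dAB : A `&` B = set0 by apply/seteqP; split => // x [Ax /BSA[]].
have okC : ok (A `|` B).
  split; first exact: measurableU.
    by move=> x [/AS//|/BSA[]].
  by rewrite fine_probabilityU //; lra.
have grow n : n%:R * (m B / 2) <= m (U n).
  elim: n => [|n IH]; first by rewrite mul0r fine_ge0.
  have [_ _ /(_ _ okC)] := nxtP _ (okU n).
  have UA : U n `<=` A by move=> x Ux; exists n.
  have UAB : U n `<=` A `|` B by move=> x /UA; left.
  move=> /(_ UAB); rewrite -/(U n.+1) fine_probabilityU //.
  have := le_fine_probability (mU n) mA UA.
  by rewrite -[n.+1%:R]natr1 (mulrDl n%:R) (mul1r (m B / 2)) => ? ?; lra.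
have tB : 0 <= t / (m B / 2) by rewrite !divr_ge0 // ltW.
have /andP[_] := truncn_itv tB.
rewrite ltr_pdivrMr ?divr_gt0 // ltNge => /negP; apply.
apply: le_trans (grow _) _.
by have [] := okU (Num.trunc (t / (m B / 2))).+1.
Qed.

End AtomlessValues.

(** * Condorcet cycles and weak orders *)

(** The Condorcet cycle. Candidates and ranks are both elements of ['I_3], with 2 the best rank, so
    each of the three cyclic rankings happens to be a transposition. *)
Definition r1 : ranking := tperm c1 c3.
Definition r2 : ranking := tperm c2 c3.
Definition r3 : ranking := tperm c1 c2.

Lemma cand_case (P : cand -> Prop) : P c1 -> P c2 -> P c3 -> forall i, P i.
Proof.
move=> P1 P2 P3 [[|[|[|//]]] lt_i3].
- by rewrite (_ : Ordinal _ = c1) //; exact: val_inj.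
- by rewrite (_ : Ordinal _ = c2) //; exact: val_inj.
- by rewrite (_ : Ordinal _ = c3) //; exact: val_inj.
Qed.

Lemma listed_r1 (r : ranking) : listed r c1 c2 c3 = (r == r1).
Proof.
apply/idP/eqP => [/and3P[/eqP a /eqP b /eqP c]|->]; last first.
  by rewrite /listed /rank_value !permE.
by apply/permP; apply: cand_case; apply: val_inj; rewrite /= !permE.
Qed.

Lemma listed_r2 (r : ranking) : listed r c2 c3 c1 = (r == r2).
Proof.
apply/idP/eqP => [/and3P[/eqP a /eqP b /eqP c]|->]; last first.
  by rewrite /listed /rank_value !permE.
by apply/permP; apply: cand_case; apply: val_inj; rewrite /= !permE.
Qed.

Lemma listed_r3 (r : ranking) : listed r c3 c1 c2 = (r == r3).
Proof.
apply/idP/eqP => [/and3P[/eqP a /eqP b /eqP c]|->]; last first.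
  by rewrite /listed /rank_value !permE.
by apply/permP; apply: cand_case; apply: val_inj; rewrite /= !permE.
Qed.

Lemma condorcet_cycleE (r : ranking) :
  condorcet_cycle r = [|| r == r1, r == r2 | r == r3].
Proof. by rewrite /condorcet_cycle listed_r1 listed_r2 listed_r3. Qed.

Lemma r12 : (r1 == r2) = false.
Proof. by rewrite -listed_r2 /listed /rank_value !permE. Qed.

Lemma r13 : (r1 == r3) = false.
Proof. by rewrite -listed_r3 /listed /rank_value !permE. Qed.

Lemma r23 : (r2 == r3) = false.
Proof. by rewrite -listed_r3 /listed /rank_value !permE. Qed.

Lemma r21 : (r2 == r1) = false.
Proof. by rewrite eq_sym r12. Qed.

Lemma r31 : (r3 == r1) = false.
Proof. by rewrite eq_sym r13. Qed.

Lemma r32 : (r3 == r2) = false.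
Proof. by rewrite eq_sym r23. Qed.

Definition rot : {perm cand} := (tperm c1 c2 * tperm c1 c3)%g.

Lemma rotE : [/\ rot c1 = c2 , rot c2 = c3 & rot c3 = c1].
Proof. by split; apply: val_inj; rewrite /= permM !permE. Qed.

Lemma rank_act_rot :
  [/\ rank_act rot r1 = r2, rank_act rot r2 = r3 & rank_act rot r3 = r1].
Proof.
have [e1 e2 e3] := rotE.
have [f1 f2 f3] : [/\ (rot^-1)%g c2 = c1, (rot^-1)%g c3 = c2
    & (rot^-1)%g c1 = c3].
  by split; apply: (@perm_inj _ rot); rewrite permKV.
by split; apply/permP; apply: cand_case; apply: val_inj;
  rewrite /= permM ?f1 ?f2 ?f3 !permE.
Qed.

Lemma rank_act_rotK (r : ranking) : rank_act rot (rank_act rot^-1 r) = r.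
Proof. by apply/permP => i; rewrite /rank_act !permM invgK permKV. Qed.

Lemma rank_act_rotVK (r : ranking) : rank_act rot^-1 (rank_act rot r) = r.
Proof. by apply/permP => i; rewrite /rank_act !permM invgK permK. Qed.

Lemma order_outcome_act (rho : {perm cand}) (w : weak_order) (i j : cand) :
  order_outcome (rho i) (rho j) (weak_act rho w) = order_outcome i j w.
Proof. by rewrite /order_outcome /= /act_beats !permK. Qed.

Lemma order_outcome_sym (w : weak_order) (i j : cand) :
  order_outcome j i w = flip (order_outcome i j w).
Proof.
rewrite /order_outcome; case E : (beats w i j); case E' : (beats w j i) => //.
by have := beats_trans E E'; rewrite beats_irr.
Qed.

(** A finite check: transitivity, asymmetry and compatibility with ties become boolean implications
    between the six strict comparisons, whose truth values are then enumerated. *)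
Lemma order_outcome_consistent (w : weak_order) :
  cyclic_consistent (order_outcome c1 c2 w) (order_outcome c2 c3 w)
    (order_outcome c3 c1 w).
Proof.
have tr i j k : beats w i j ==> beats w j k ==> beats w i k.
  by apply/implyP => ij; apply/implyP; exact: beats_trans ij.
have asym i j : beats w i j ==> ~~ beats w j i.
  by apply/implyP => ij; apply/negP => /(beats_trans ij); rewrite beats_irr.
have tiel i j k : tied w i j ==> (beats w i k == beats w j k).
  apply/implyP => ij; apply/eqP; apply: beats_tied => //.
  by rewrite /tied beats_irr.
have tier i j k : tied w i j ==> (beats w k i == beats w k j).
  apply/implyP => ij; apply/eqP; apply: beats_tied => //.
  by rewrite /tied beats_irr.
move: (tr c1 c2 c3) (tr c2 c3 c1) (tr c3 c1 c2).
move: (tr c1 c3 c2) (tr c3 c2 c1) (tr c2 c1 c3).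
move: (asym c1 c2) (asym c2 c3) (asym c3 c1).
move: (tiel c1 c2 c3) (tiel c2 c3 c1) (tiel c3 c1 c2).
move: (tier c1 c2 c3) (tier c2 c3 c1) (tier c3 c1 c2).
rewrite /order_outcome /tied {tr asym tiel tier}.
by case: (w c1 c2); case: (w c2 c1); case: (w c2 c3); case: (w c3 c2);
  case: (w c3 c1); case: (w c1 c3).
Qed.

(** * The common pairwise rule *)

Section Election.
Context d (V : measurableType d) (R : realType).
Variables (nu : probability V R) (F : swf V).
Hypotheses (atomless_nu : atomless nu) (CC_F : CC F) (MIIA_F : MIIA F).
Hypothesis (neutral_F : neutral F).
Variable F' : set_type (tau nu @` dom F) -> weak_order.
Hypothesis F'E : factors_through_tau F'.

Local Notation m A := (fine (nu A)).

Lemma measurable_ranking_fiber (e : V -> ranking) (r : ranking) :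
  measurable_fun [set: V] e -> measurable (e @^-1` [set r]).
Proof. by move=> me; rewrite -[X in measurable X]setTI; exact: me. Qed.

Lemma domE (e : V -> ranking) :
  dom F e = (measurable_fun [set: V] e /\ forall v, condorcet_cycle (e v)).
Proof. by rewrite CC_F. Qed.

Lemma dom_cycle (e : set_type (dom F)) v :
  [\/ val e v = r1, val e v = r2 | val e v = r3].
Proof.
have := set_valP e; rewrite domE => -[_ /(_ v)].
rewrite condorcet_cycleE => /or3P[] /eqP ->; [exact: Or31 | exact: Or32 | exact: Or33].
Qed.

Lemma dom_measurable_fiber (e : set_type (dom F)) (r : ranking) :
  measurable (val e @^-1` [set r]).
Proof. by apply: measurable_ranking_fiber; apply: dom_measurable; exact: set_valP. Qed.

Lemma tau_ge0 (e : V -> ranking) r : 0 <= tau nu e r.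
Proof. exact: fine_ge0. Qed.

Lemma tau_sum (e : set_type (dom F)) :
  tau nu (val e) r1 + tau nu (val e) r2 + tau nu (val e) r3 = 1.
Proof.
have mf := dom_measurable_fiber e.
rewrite /tau -!fine_probabilityU //; try exact: measurableU.
- rewrite (_ : _ `|` _ = setT) ?probability_setT //.
  apply/seteqP; split => // v _ /=.
  by have [->|->|->] := dom_cycle e v; [left; left|left; right|right].
- apply/seteqP; split => // v /= [[->|->] /eqP]; by rewrite ?r13 ?r23.
- apply/seteqP; split => // v /= [-> /eqP]; by rewrite r12.
Qed.

Lemma tau_simplex_chart (e : set_type (dom F)) :
  tau nu (val e) = simplex_chart (tau nu (val e) r1, tau nu (val e) r2).
Proof.
apply/funext => r; rewrite /simplex_chart listed_r1 listed_r2 listed_r3 /=.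
case: eqP => [->//|n1]; case: eqP => [->//|n2]; case: eqP => [->|n3].
  by have := tau_sum e; lra.
rewrite /tau (_ : _ @^-1` _ = set0) ?measure0 //.
apply/seteqP; split => // v /= evr; rewrite -evr in n1 n2 n3.
by case: (dom_cycle e v); [exact: n1 | exact: n2 | exact: n3].
Qed.

Definition election (S T : set V) (v : V) : ranking :=
  if v \in S then r1 else if v \in T then r2 else r3.

Lemma measurable_mem (S : set V) : measurable S ->
  measurable_fun [set: V] (fun v => v \in S).
Proof.
move=> mS; apply: (measurable_fun_bool true); rewrite setTI.
rewrite (_ : _ @^-1` _ = S) //; apply/seteqP; split => v /=; first by move/set_mem.
by move/mem_set.
Qed.

Lemma dom_election (S T : set V) : measurable S -> measurable T ->
  dom F (election S T).
Proof.
move=> mS mT; rewrite domE; split.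
  apply: measurable_fun_ifT; [exact: measurable_mem | by [] |].
  by apply: measurable_fun_ifT; [exact: measurable_mem | by [] |].
move=> v; rewrite condorcet_cycleE /election.
by case: ifP => _; [|case: ifP => _]; rewrite eqxx ?orbT.
Qed.

Lemma election_r1 (S T : set V) : election S T @^-1` [set r1] = S.
Proof.
apply/seteqP; split => v /=; rewrite /election.
  case: ifP => [/set_mem //|_]; case: ifP => _ /eqP; first by rewrite eq_sym r12.
  by rewrite eq_sym r13.
by move/mem_set => ->.
Qed.

Lemma election_r2 (S T : set V) : S `&` T = set0 ->
  election S T @^-1` [set r2] = T.
Proof.
move=> ST; apply/seteqP; split => v /=; rewrite /election.
  case: ifP => _; first by move/eqP; rewrite r12.
  case: ifP => [/set_mem //|_] /eqP; by rewrite eq_sym r23.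
move=> Tv; case: ifP => [/set_mem Sv|_]; last by rewrite mem_set.
by have : set0 v by rewrite -ST.
Qed.

(** The supporters of [r2] are prescribed as a set, as MIIA requires, those of [r1] only by their
    weight; the latter are taken from the complement of [T]. *)
Lemma exists_election (x : R) (T : set V) : measurable T -> 0 <= x ->
  x + m T <= 1 -> exists e : set_type (dom F),
    val e @^-1` [set r2] = T /\ tau nu (val e) r1 = x.
Proof.
move=> mT x0 xT.
have mTC : measurable (~` T) by exact: measurableC.
have [||S [mS ST mSx]] := @atomless_intermediate _ _ _ nu (~` T) x atomless_nu => //.
  have : m (~` T) + m T = 1.
    by rewrite -fine_probabilityU ?setICl // setUC setUv probability_setT.
  by move=> ?; apply/andP; split => //; lra.
exists (SigSub (mem_set (dom_election mS mT))); split => /=.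
  by apply: election_r2; apply/seteqP; split => // v [/ST].
by rewrite /tau election_r1.
Qed.

Lemma tau_realized (x y : R) : 0 <= x -> 0 <= y -> x + y <= 1 ->
  exists e : set_type (dom F), tau nu (val e) r1 = x /\ tau nu (val e) r2 = y.
Proof.
move=> x0 y0 xy.
have [||T [mT _ mTy]] := @atomless_intermediate _ _ _ nu setT y atomless_nu => //.
  by rewrite probability_setT /=; apply/andP; split => //; lra.
have [||e [eT ex]] := @exists_election x T mT => //; first by rewrite mTy.
by exists e; split => //; rewrite /tau eT.
Qed.

Lemma swf_eq_tau (e e' : set_type (dom F)) :
  tau nu (val e) = tau nu (val e') -> F e = F e'.
Proof. by move=> ee'; rewrite !F'E; congr F'; exact: val_inj. Qed.

(** Among cyclic rankings, the rank difference of [c1] and [c2] is -2 at [r2] and 1 at both others,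
    so the fiber of [r2] determines all that MIIA looks at. *)
Lemma outcome_eq_fiber (e e' : set_type (dom F)) :
  val e @^-1` [set r2] = val e' @^-1` [set r2] ->
  order_outcome c1 c2 (F e) = order_outcome c1 c2 (F e').
Proof.
move=> ee'; have [//|f fE] := MIIA_F (i := c1) (j := c2).
rewrite -!fE; congr f; apply: val_inj => /=; apply/funext => v.
have H : (val e v = r2) = (val e' v = r2).
  exact: (congr1 (fun S : set V => S v) ee').
have eqb : (val e v == r2) = (val e' v == r2) by apply/eqP/eqP; rewrite H.
have dE (e1 : set_type (dom F)) :
    rank_diff c1 c2 (val e1 v) = if val e1 v == r2 then -2 else 1.
  by have [->|->|->] := dom_cycle e1 v; rewrite ?r12 ?eqxx 1?eq_sym ?r23
    /rank_diff /rank_value !permE.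
by rewrite /diff_profile; move: (dE e) (dE e') => /= -> ->; move: eqb => /= ->.
Qed.

(* An intermediate election agrees with [e] on who ranks [c2 c3 c1] and has the
   distribution of [e']. *)
Lemma outcome_eq_tau (e e' : set_type (dom F)) :
  tau nu (val e) r2 = tau nu (val e') r2 ->
  order_outcome c1 c2 (F e) = order_outcome c1 c2 (F e').
Proof.
move=> ee'; have [||e2 [e2r2 e2r1]] := @exists_election
    (tau nu (val e') r1) (val e @^-1` [set r2]) (dom_measurable_fiber e r2).
- exact: tau_ge0.
- rewrite -/(tau nu (val e) r2) ee'.
  by have := tau_sum e'; have := tau_ge0 (val e') r3; lra.
have -> : F e' = F e2.
  apply: swf_eq_tau; rewrite (tau_simplex_chart e') (tau_simplex_chart e2) e2r1; congr (simplex_chart (_, _)).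
  by rewrite -ee' /tau e2r2.
exact: outcome_eq_fiber.
Qed.

(** [e0] is [e] followed by the inverse rotation of rankings. Neutrality transports its outcomes, so
    a rule for one pair of candidates passes to the next pair of the cycle. *)
Lemma unrotate (e : set_type (dom F)) : exists e0 : set_type (dom F),
  [/\ forall i j, order_outcome (rot i) (rot j) (F e) = order_outcome i j (F e0),
    tau nu (val e0) r2 = tau nu (val e) r3 &
    tau nu (val e0) r3 = tau nu (val e) r1].
Proof.
have [a1 a2 a3] := rank_act_rot.
have dom_e0 : dom F (rank_act rot^-1 \o val e).
  rewrite domE; split.
    apply: (@measurableT_comp _ _ _ _ _ _ (rank_act rot^-1)) => //.
    by apply: dom_measurable; exact: set_valP.
  move=> v; rewrite /= condorcet_cycleE.
  have b1 : rank_act rot^-1 r1 = r3 by rewrite -a3 rank_act_rotVK.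
  have b2 : rank_act rot^-1 r2 = r1 by rewrite -a1 rank_act_rotVK.
  have b3 : rank_act rot^-1 r3 = r2 by rewrite -a2 rank_act_rotVK.
  by have [->|->|->] := dom_cycle e v; rewrite ?b1 ?b2 ?b3 eqxx ?orbT.
pose e0 : set_type (dom F) := SigSub (mem_set dom_e0).
have fib r : val e0 @^-1` [set r] = val e @^-1` [set rank_act rot r].
  apply/seteqP; split => v /= H; first by rewrite -H rank_act_rotK.
  by rewrite H rank_act_rotVK.
exists e0; split.
- move=> i j; rewrite (neutral_F (rho := rot) (e := e0) (e' := e)).
    exact: order_outcome_act.
  by move=> v; rewrite /= rank_act_rotK.
- by rewrite /tau fib a2.
- by rewrite /tau fib a3.
Qed.

Lemma exists_rule : exists h : R -> outcome, forall e : set_type (dom F),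
  [/\ order_outcome c1 c2 (F e) = h (tau nu (val e) r2),
    order_outcome c2 c3 (F e) = h (tau nu (val e) r3) &
    order_outcome c3 c1 (F e) = h (tau nu (val e) r1)].
Proof.
have /choice[h hE] : forall x : R, exists o, forall e : set_type (dom F),
    tau nu (val e) r2 = x -> order_outcome c1 c2 (F e) = o.
  move=> x; have [[e0 e0x]|no] := pselect (exists e0 : set_type (dom F),
      tau nu (val e0) r2 = x).
    by exists (order_outcome c1 c2 (F e0)) => e ex; apply: outcome_eq_tau; rewrite ex.
  (* A default at reals that are not the weight of [r2] in any election. *)
  by exists Tie => e ex; case: no; exists e.
have [t1 t2 t3] := rotE.
have h23 (e : set_type (dom F)) :
    order_outcome c2 c3 (F e) = h (tau nu (val e) r3).
  have [e0 [oE <- _]] := unrotate e.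
  by have := oE c1 c2; rewrite t1 t2 => ->; exact: hE.
exists h => e; split => //; first exact: hE.
have [e0 [oE _ <-]] := unrotate e.
by have := oE c2 c3; rewrite t2 t3 h23.
Qed.

End Election.

(** * Borda scores *)

Section Borda.
Context d (V : measurableType d) (R : realType).
Variables (nu : probability V R) (F : swf V).
Hypothesis CC_F : CC F.

(** The integrand is a combination of the indicators of the three fibers. *)
Lemma expected_rank (e : set_type (dom F)) (c : cand) :
  \int[nu]_(v in [set: V]) (rank_value (val e v) c)%:R =
  (rank_value r1 c)%:R * tau nu (val e) r1 +
  (rank_value r2 c)%:R * tau nu (val e) r2 +
  (rank_value r3 c)%:R * tau nu (val e) r3 :> R.
Proof.
pose P r : set V := val e @^-1` [set r].
have mP r : measurable (P r) by exact: dom_measurable_fiber.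
have intI r : nu.-integrable [set: V] (EFin \o (\1_(P r) : V -> R)).
  exact: integrable_indic.
have intZ (a : R) r : nu.-integrable [set: V] (EFin \o (fun v => a * \1_(P r) v)).
  by have := integrableZl measurableT a (intI r).
have I r (a : R) : \int[nu]_(v in [set: V]) (a * \1_(P r) v) = a * tau nu (val e) r.
  rewrite RintegralZl //; congr (_ * _).
  by rewrite /Rintegral /= integral_indic // setIT.
rewrite (_ : (fun v : V => _) = (fun v => (rank_value r1 c)%:R * \1_(P r1) v +
    (rank_value r2 c)%:R * \1_(P r2) v + (rank_value r3 c)%:R * \1_(P r3) v)).
  rewrite RintegralD ?RintegralD ?I //.
  by have := integrableD measurableT (intZ (rank_value r1 c)%:R r1)
    (intZ (rank_value r2 c)%:R r2).
apply/funext => v; rewrite !indicE.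
have P_in r : (v \in P r) = (val e v == r).
  by apply/idP/eqP => [/set_mem //|evr]; apply/mem_set.
by rewrite !P_in; have [->|->|->] := dom_cycle CC_F e v;
  rewrite eqxx ?r12 ?r13 ?r23 ?r21 ?r31 ?r32 /= mulr1 !mulr0 ?addr0 ?add0r.
Qed.

(** [s] is the expected rank. If [r2] has weight [t], then [c2] is 2 ranks above [c1] with weight
    [t] and 1 rank below with weight [1 - t]: the gap is [3 * t - 1]. The other pairs follow the
    cycle. *)
Lemma borda_score_gaps (w : R) (e : set_type (dom F)) :
  exists s : cand -> R,
  [/\ forall c, borda_score nu w c (val e) = w * s c,
    s c2 - s c1 = 3 * (tau nu (val e) r2 - 1/3),
    s c3 - s c2 = 3 * (tau nu (val e) r3 - 1/3) &
    s c1 - s c3 = 3 * (tau nu (val e) r1 - 1/3)].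
Proof.
exists (fun c => \int[nu]_(v in [set: V]) (rank_value (val e v) c)%:R); split => //;
  rewrite !expected_rank /rank_value !permE /=;
  have := tau_sum nu CC_F e; lra.
Qed.

End Borda.

(** * From a level set of positive measure to the Borda weight *)

Theorem mainTheorem4 (R : realType) (d : measure_display) (V : measurableType d)
    (nu : probability V R) (F : swf V) :
  infinite_set [set: V] ->
  atomless nu ->
  CC F ->
  MIIA F ->
  anonymous nu F ->
  neutral F ->
  measurable_swf nu F ->
  unweighted_borda_rule nu F.
Proof.
move=> _ al cc miia _ neu [F' F'E F'meas].
have [h hE] := exists_rule al cc miia neu F'E.
pose k a := h (1/3 + a).
have kcyc : cyclic_rule k.
  move=> a b c a0 b0 c0 abc.
  (* The weights of [r2], [r3], [r1] become [1/3 + a], [1/3 + b], [1/3 + c], in the order in which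
     [h] decides the three pairs. *)
  have [| | |e [e1 e2]] := @tau_realized _ _ _ nu F al cc (1/3 + c) (1/3 + a); try lra.
  have [h12 h23 h31] := hE e; have := order_outcome_consistent (F e).
  have e3 : tau nu (val e) r3 = 1/3 + b by have := tau_sum nu cc e; lra.
  by rewrite h12 h23 h31 e1 e2 e3.
pose S o := [set z : R * R | exists2 p, val p = simplex_chart z &
  order_outcome c1 c2 (F' p) = o].
have mS o : lebesgue_measurable2 (S o).
  exact: (F'meas [set w | order_outcome c1 c2 w = o]).
(* A rectangle inside the simplex, as [1/3 + 1/2 < 1], on which the deviation of the second weight
   runs over [[0, 1/6]]. *)
pose Q : set (R * R) := `[0, 1/3] `*` `[1/3, 1/2].
have mQ : measurable Q by apply: measurableX; exact: measurable_itv.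
(* On [Q], membership in [S o] depends on the second coordinate alone. *)
have Sh x y : Q (x, y) -> S (h y) (x, y) /\ forall o, S o (x, y) -> h y = o.
  rewrite /Q /= !in_itv /= => -[/andP[x0 x1] /andP[y0 y1]].
  have [| | |e [e1 e2]] := @tau_realized _ _ _ nu F al cc x y; try lra.
  have te : tau nu (val e) = simplex_chart (x, y).
    by rewrite (tau_simplex_chart nu cc e) e1 e2.
  have he : order_outcome c1 c2 (F' (to_image (tau nu) e)) = h y.
    by rewrite -F'E -e2; have [] := hE e.
  split; first by exists (to_image (tau nu) e).
  move=> o [p pE <-]; rewrite -he; congr (order_outcome _ _ (F' _)).
  by apply: val_inj; rewrite pE -te.
(* The three sets [S o] cover [Q], which has positive area. *)
have [ o So] : exists o, ~ ((@lebesgue_measure R) \x (@lebesgue_measure R))%E.-negligible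
    (S o `&` Q).
  apply: contrapT => all0.
  have neg o : ((@lebesgue_measure R) \x (@lebesgue_measure R))%E.-negligible (S o `&` Q).
    by apply: contrapT => ?; apply: all0; exists o.
  apply: (@rectangle_not_negligible R 0 (1/3) (1/3) (1/2)); try lra.
  apply: negligibleS (negligibleU (negligibleU (neg Win) (neg Tie)) (neg Loss)).
  move=> [x y] Qxy; have [Shy _] := Sh _ _ Qxy; move: Shy.
  by case: (h y) => ?; [left; left|left; right|right].
have [x [A [mA A0 AS]]] := plane_positive_section (lebesgue_measurable2_setI (mS o) mQ) So.
have kpos := @cyclic_rule_measurable R k A (1/3) o kcyc mA A0.
have {}kpos : forall t, 0 < t <= 2/3 -> k t = o.
  apply: kpos => y /AS[Sxy Qxy]; split.
    by move: Qxy; rewrite /Q /= !in_itv /= => -[_ /andP[? ?]]; apply/andP; split; lra.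
  rewrite /k addrC subrK; have [_] := Sh _ _ Qxy; exact.
have [w kw] := cyclic_rule_compare kcyc kpos.
have cmp e i j t : order_outcome i j (F e) = h t -> 0 <= t <= 1 ->
    forall s : cand -> R, s j - s i = 3 * (t - 1/3) ->
  (beats (F e) i j = (w * s j < w * s i)) /\ (beats (F e) j i = (w * s i < w * s j)).
  move=> oE /andP[t0 t1] s st.
  have ht : h t = compare_outcome (w * s i) (w * s j).
    rewrite -(kw (t - 1/3)) //; last by apply/andP; split; lra.
    by rewrite /k addrC subrK.
  have oji := order_outcome_sym (F e) i j.
  move: oE oji; rewrite ht /compare_outcome /order_outcome.
  by case: ltgtP; case: (beats (F e) i j); case: (beats (F e) j i).
exists w => e.
have [h12 h23 h31] := hE e.
have [s [sE s12 s23 s31]] := borda_score_gaps nu cc w e.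
have [bnd1 bnd2 bnd3] : [/\ 0 <= tau nu (val e) r1 <= 1,
    0 <= tau nu (val e) r2 <= 1 & 0 <= tau nu (val e) r3 <= 1].
  have := tau_sum nu cc e; have := tau_ge0 nu (val e) r1.
  have := tau_ge0 nu (val e) r2; have := tau_ge0 nu (val e) r3.
  by move=> *; split; apply/andP; split; lra.
have [b12 b21] := cmp e _ _ _ h12 bnd2 s s12.
have [b23 b32] := cmp e _ _ _ h23 bnd3 s s23.
have [b31 b13] := cmp e _ _ _ h31 bnd1 s s31.
by apply: cand_case; apply: cand_case; rewrite !sE ?beats_irr ?ltxx.
Qed.
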